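(* Let $\{S(t): t\ge 0\}$ be an asymptotically closed semigroup on a complete metric space $(V,d)$, $T>0$ and let $\mathbf{B}\subseteq V$ be a bounded absorbing set for the semigroup. If the semigroup is quasi-stable on $\mathbf{B}$ at time $T$ with respect to a compact seminorm $\mathfrak{n}_Z$ and parameters $(\eta,\kappa)$, then for any $\sigma\in(0,1-\eta)$ there exists a $T$-discrete exponential attractor $\mathbf{M_0}\subseteq\mathbf{B}$ in $V$ for the semigroup with rate of attraction $\xi\in(0,\frac{1}{T}\ln\frac{1}{\eta+\sigma})$, and its fractal dimension is bounded by $$\dim_f^{V}(\mathbf{M_0})\le\log_{\frac{1}{\eta+\sigma}}\mathfrak{m}_{Z}\left(\tfrac{\sigma}{2\kappa}\right).$$ Moreover, the semigroup has a global attractor $\mathbf{A}$ contained in $\mathbf{M_0}$.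
   Context: Metric spaces are nonempty. A semigroup $\{S(t):t\ge0\}$ on a metric space $(V,d)$ is a family of maps $S(t):V\to V$ with $S(t)S(s)=S(t+s)$ for $t,s\ge 0$ and $S(0)=I$; ''$t\ge 0$'' means throughout either $t\in[0,\infty)$ or $t\in\mathbb{N}_0=\{0,1,2,\dots\}$ (and $T$ belongs to the time set). Asymptotically closed: for any $t\ge 0$, $t_k\ge 0$ with $t_k\to\infty$ and any bounded sequence $x_k\in V$, if $S(t_k)x_k\to x$ and $S(t+t_k)x_k\to y$ with $x,y\in V$, then $S(t)x=y$. Absorbing set: $\mathbf{B}\subseteq V$ such that for every bounded $G\subseteq V$ there is $t_G\ge 0$ with $S(t)G\subseteq\mathbf{B}$ for all $t\ge t_G$. A compact seminorm on a normed space $Z$ is a seminorm $\mathfrak{n}_Z:Z\to[0,\infty)$ such that any bounded sequence $z_k\in Z$ has a subsequence $z_{k_j}$ with $\mathfrak{n}_Z(z_{k_j}-z_{k_l})\to0$ as $j,l\to\infty$. The semigroup is quasi-stable on a set $B\subseteq V$ at time $T>0$ with respect to a compact seminorm $\mathfrak{n}_Z$ and parameters $(\eta,\kappa)$ if $\eta\in[0,1)$, $\kappa>0$ and there is a map $K:B\to Z$ into the normed space $Z$ such that for all $x,y\in B$ $$\|Kx-Ky\|_Z\le\kappa\, d(x,y),\qquad d(S(T)x,S(T)y)\le\eta\, d(x,y)+\mathfrak{n}_Z(Kx-Ky).$$ $\mathfrak{m}_Z(\mu)$ denotes the maximal cardinality of a subset $U$ of the closed unit ball $\{z\in Z:\|z\|_Z\le1\}$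 such that $\mathfrak{n}_Z(x-y)\ge\mu$ for all $x,y\in U$, $x\ne y$. $\mathrm{dist}^V(G,H)=\sup_{x\in G}\inf_{y\in H}d(x,y)$. $N^V(G,\varepsilon)$ is the minimal number of open $\varepsilon$-balls in $V$ centered at points of $G$ needed to cover $G$; $\dim_f^V(G)=\limsup_{\varepsilon\to0^+}\log_{1/\varepsilon}N^V(G,\varepsilon)$. Global attractor: a nonempty compact set $\mathbf{A}\subseteq V$ with $S(t)\mathbf{A}=\mathbf{A}$ for all $t\ge 0$ and $\lim_{t\to\infty}\mathrm{dist}^V(S(t)G,\mathbf{A})=0$ for every bounded $G\subseteq V$. $T$-discrete exponential attractor: a nonempty compact set $\mathbf{M_0}\subseteq V$ such that $S(T)\mathbf{M_0}\subseteq\mathbf{M_0}$, $\dim_f^V(\mathbf{M_0})<\infty$, and there is $\xi>0$ with $\lim_{t\to\infty}e^{\xi t}\mathrm{dist}^V(S(t)G,\mathbf{M_0})=0$ for every bounded $G\subseteq V$. ''With rate of attraction $\xi\in(0,\xi_0)$'' means that this limit holds for every $\xi\in(0,\xi_0)$ and every bounded $G$. *)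

(* Defs.v *)
From HB Require Import structures.
From mathcomp Require Import all_boot all_order all_algebra finmap.
From mathcomp Require Import all_classical all_reals all_analysis.

Set Implicit Arguments.
Unset Strict Implicit.
Unset Printing Implicit Defensive.

Import Order.TTheory GRing.Theory Num.Theory.
Import numFieldNormedType.Exports.

Local Open Scope classical_set_scope.
Local Open Scope ring_scope.

(* For b > 1 and x in [0, +oo], the logarithm of x in base b. *)
Definition loge (R : realType) (b : R) (x : \bar R) : \bar R :=
  (lne x / (ln b)%:E)%E.

Definition complete_space (R : realType) (V : metricType R) : Prop :=
  forall F : set_system V, ProperFilter F -> cauchy F -> exists x : V, F --> x.

Definition mbounded (R : realType) (V : metricType R) (A : set V) : Prop :=
  exists M : R, forall x y, A x -> A y -> mdist x y <= M.

(* The supremum is taken in [0, +oo]: the value is 0 when G is empty, and +oo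
   when H is empty and G is not. *)
Definition hausdorff_semidist (R : realType) (V : metricType R) (G H : set V)
    : \bar R :=
  ereal_sup (0%E |`
    [set ereal_inf [set (mdist x y)%:E | y in H] | x in G]).

(* +oo when no finite cover exists. *)
Definition covering_number (R : realType) (V : metricType R) (G : set V)
    (e : R) : \bar R :=
  ereal_inf [set (#|` C|%:R)%:E | C in
    [set C : {fset V} | [set` C] `<=` G /\ G `<=` \bigcup_(c in [set` C]) ball c e]].

Definition fractal_dim (R : realType) (V : metricType R) (G : set V) : \bar R :=
  limf_esup (fun e : R => loge e^-1 (covering_number G e)) 0^'+.

Definition is_seminorm (R : realType) (Z : normedModType R) (nZ : Z -> R)
    : Prop :=
  [/\ forall z, 0 <= nZ z,
      forall x y, nZ (x + y) <= nZ x + nZ y &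
      forall (a : R) z, nZ (a *: z) = `|a| * nZ z].

Definition compact_seminorm (R : realType) (Z : normedModType R) (nZ : Z -> R)
    : Prop :=
  is_seminorm nZ /\
  forall z : nat -> Z, bounded_set (range z) ->
    exists2 phi : nat -> nat, {homo phi : i j / (i < j)%N} &
      (fun jl : nat * nat => nZ (z (phi jl.1) - z (phi jl.2)))
        @ filter_prod \oo \oo --> (0 : R).

(* The maximal cardinality, as a supremum over finite subsets: a finite value is
   attained, and the value is +oo when there are arbitrarily large (in
   particular, infinite) separated sets. *)
Definition max_separated (R : realType) (Z : normedModType R) (nZ : Z -> R)
    (mu : R) : \bar R :=
  ereal_sup [set (#|` U|%:R)%:E | U in
    [set U : {fset Z} | (forall z, z \in U -> `|z| <= 1) /\
      (forall x y, x \in U -> y \in U -> x != y -> mu <= nZ (x - y))]].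

(* The time set is [0, +oo[ or the natural numbers, both seen inside R.
   A semigroup is a map S : R -> V -> V of which only the values at times in TT
   are ever used. *)
Definition is_time_set (R : realType) (TT : set R) : Prop :=
  TT = [set t : R | 0 <= t] \/ TT = range (fun n : nat => n%:R : R).

Definition is_semigroup (R : realType) (V : metricType R) (TT : set R)
    (S : R -> V -> V) : Prop :=
  (forall x, S 0 x = x) /\
  (forall t s, TT t -> TT s -> forall x, S t (S s x) = S (t + s) x).

Definition asymptotically_closed (R : realType) (V : metricType R)
    (TT : set R) (S : R -> V -> V) : Prop :=
  forall (t : R) (t_ : nat -> R) (x_ : nat -> V) (x y : V),
    TT t -> (forall k, TT (t_ k)) -> t_ @ \oo --> +oo ->
    mbounded (range x_) ->
    (fun k => S (t_ k) (x_ k)) @ \oo --> x ->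
    (fun k => S (t + t_ k) (x_ k)) @ \oo --> y ->
    S t x = y.

Definition absorbing (R : realType) (V : metricType R) (TT : set R)
    (S : R -> V -> V) (B : set V) : Prop :=
  forall G : set V, mbounded G ->
    exists2 tG, TT tG & forall t, TT t -> tG <= t -> S t @` G `<=` B.

(* K is only used on B, so it is taken to be defined on all of V. *)
Definition quasi_stable (R : realType) (V : metricType R)
    (Z : normedModType R) (S : R -> V -> V) (B : set V) (T : R)
    (nZ : Z -> R) (eta kappa : R) : Prop :=
  [/\ 0 < T, compact_seminorm nZ, 0 <= eta < 1, 0 < kappa &
    exists K : V -> Z, forall x y, B x -> B y ->
      `|K x - K y| <= kappa * mdist x y /\
      mdist (S T x) (S T y) <= eta * mdist x y + nZ (K x - K y)].

Definition global_attractor (R : realType) (V : metricType R) (TT : set R)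
    (S : R -> V -> V) (A : set V) : Prop :=
  [/\ A !=set0, compact A, forall t, TT t -> S t @` A = A &
    forall G : set V, mbounded G ->
      hausdorff_semidist (S t @` G) A
        @[t --> within TT (pinfty_nbhs R)] --> 0%E].

Definition attracts_at_rate (R : realType) (V : metricType R) (TT : set R)
    (S : R -> V -> V) (M : set V) (xi : R) : Prop :=
  forall G : set V, mbounded G ->
    ((expR (xi * t))%:E * hausdorff_semidist (S t @` G) M)%E
      @[t --> within TT (pinfty_nbhs R)] --> 0%E.

Definition discrete_exponential_attractor (R : realType) (V : metricType R)
    (TT : set R) (S : R -> V -> V) (T : R) (M : set V) : Prop :=
  [/\ M !=set0, compact M, S T @` M `<=` M, (fractal_dim M < +oo)%E &
    exists2 xi : R, 0 < xi & attracts_at_rate TT S M xi].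

(* Main.v *)
(* The map [f = S T] splits any piece of diameter [d] of the absorbing set into
   [m] sets whose images have diameter at most [(eta + sigma) d]: group the
   points around a maximal subset whose [K]-images are [sigma d / 2]-separated
   for the seminorm; after rescaling by [kappa d] such a subset fits in the unit
   ball, so it has at most [m = m_Z(sigma / (2 kappa))] elements. Iterating,
   the n-th forward image [W n] of the absorbing set is covered by [m ^ n] sets
   of diameter at most [(eta + sigma) ^ n * D], which yields finite nets. The
   intersection of the closures of the [W n] is the global attractor, and adding
   to it the nets, made forward invariant by including their images, gives
   [M0]: at scale [(eta + sigma) ^ n * D] only the first [n] nets are needed to
   cover [M0], and their total size is polynomial in [n] times [m ^ n]. *)
Require Import Defs.
From HB Require Import structures.
From mathcomp Require Import all_boot all_order all_algebra finmap.
From mathcomp Require Import all_classical all_reals all_analysis.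
From mathcomp Require Import ring lra.

Set Implicit Arguments.
Unset Strict Implicit.
Unset Printing Implicit Defensive.

Import Order.TTheory GRing.Theory Num.Theory.
Import numFieldNormedType.Exports.

Local Open Scope classical_set_scope.
Local Open Scope ring_scope.

(** * Separated sets for a compact seminorm *)

Section CompactSeminorm.
Context (R : realType) (Z : normedModType R) (nZ : Z -> R).

Lemma seminorm0 : is_seminorm nZ -> nZ 0 = 0.
Proof. by move=> [_ _ nZs]; rewrite -(scale0r 0) nZs normr0 mul0r. Qed.

Lemma seminormB_sym x y : is_seminorm nZ -> nZ (x - y) = nZ (y - x).
Proof.
by move=> [_ _ nZs]; rewrite -opprB -scaleN1r nZs normrN1 mul1r.
Qed.

Lemma seminorm_triangle x y z : is_seminorm nZ ->
  nZ (x - z) <= nZ (x - y) + nZ (y - z).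
Proof.
by move=> [_ nZD _]; rewrite (le_trans _ (nZD _ _))// addrA subrK.
Qed.

(* Otherwise one can pick greedily a sequence in the unit ball that is
   separated for the seminorm, hence has no Cauchy subsequence. *)
Lemma unit_ball_finite_net (mu : R) : compact_seminorm nZ -> 0 < mu ->
  exists s : seq Z, forall z, `|z| <= 1 -> exists2 p, p \in s & nZ (z - p) < mu.
Proof.
move=> [nZ_seminorm nZ_compact] mu0; apply: contrapT => noNet.
have step (s : seq Z) :
    exists z, `|z| <= 1 /\ forall p, p \in s -> mu <= nZ (z - p).
  apply: contrapT => Hs; apply: noNet; exists s => z z1.
  apply: contrapT => Hz; apply: Hs; exists z; split=> // p ps.
  by rewrite leNgt; apply/negP => ltmu; apply: Hz; exists p.
have [next nextP] := choice step.
pose prefix n := iter n (fun s => next s :: s) [::].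
pose z n := next (prefix n).
have z_prefix i j : (i < j)%N -> z i \in prefix j.
  elim: j => // j IHj; rewrite ltnS leq_eqVlt => /orP[/eqP ->|/IHj ij].
    by rewrite /= in_cons eqxx.
  by rewrite /= in_cons ij orbT.
have z_bounded : bounded_set (range z).
  exists 1; split; first exact: num_real.
  by move=> M M1 _ [n _ <-] /=; rewrite (le_trans (nextP _).1)// ltW.
have [phi phi_incr nZ0] := nZ_compact z z_bounded.
have /cvgrPdist_lt/(_ _ mu0) := nZ0.
case=> -[P Q] /= [[N _ NP] [M _ MQ]] PQ.
pose k := maxn N M.
have kP : P k.+1 by apply: NP; rewrite /= (leq_trans (leq_maxl N M)).
have kQ : Q k by apply: MQ; rewrite /= leq_maxr.
have := PQ (k.+1, k) (conj kP kQ).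
rewrite /= sub0r normrN => nZlt.
have := (nextP (prefix (phi k.+1))).2 _ (z_prefix _ _ (phi_incr _ _ (ltnSn k))).
by rewrite leNgt (le_lt_trans _ nZlt)// ler_norm.
Qed.

(** A seminorm ball of radius [mu / 2] holds at most one point of a separated set, so a finite
    [mu / 2]-net bounds all cardinalities and a maximum exists. The singleton of [0] makes it
    positive. *)
Lemma max_separated_attained (mu : R) : compact_seminorm nZ -> 0 < mu ->
  exists m : nat, [/\ (0 < m)%N, (m%:R%:E <= max_separated nZ mu)%E &
    forall U : {fset Z}, (forall z, z \in U -> `|z| <= 1) ->
      (forall x y, x \in U -> y \in U -> x != y -> mu <= nZ (x - y)) ->
      (#|` U| <= m)%N].
Proof.
move=> nZc mu0; have nZs := nZc.1; have mu20 : 0 < mu / 2 by rewrite divr_gt0.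
have [s sP] := unit_ball_finite_net nZc mu20.
pose separated (U : {fset Z}) := (forall z, z \in U -> `|z| <= 1) /\
  (forall x y, x \in U -> y \in U -> x != y -> mu <= nZ (x - y)).
have bound U : separated U -> (#|` U| <= size s)%N.
  move=> [U1 Usep].
  have /choice[g gP] : forall z, exists p, z \in U -> p \in s /\ nZ (z - p) < mu / 2.
    move=> z; have [zU|_] := boolP (z \in U); last by exists 0.
    by have [p ps pz] := sP z (U1 z zU); exists p.
  have g_inj : {in U &, injective g}.
    move=> x y xU yU gxy; apply/eqP/negPn/negP => /(Usep x y xU yU).
    rewrite leNgt => /negP; apply.
    rewrite (le_lt_trans (seminorm_triangle _ (g x) _ nZs))//.
    rewrite (splitr mu) ltrD//; first exact: (gP x xU).2.
    by rewrite gxy seminormB_sym//; exact: (gP y yU).2.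
  rewrite -(card_in_imfset imfset_key g_inj) /=.
  rewrite (leq_trans _ (size_undup s))// -card_fseq fsubset_leq_card//.
  apply/fsubsetP => p /imfsetP[/= z zU ->]; rewrite inE.
  exact: (gP z zU).1.
pose P n := `[< exists2 U, separated U & #|` U| = n >].
have P1 : P 1%N.
  apply/asboolP; exists [fset 0]%fset; last by rewrite cardfs1.
  split=> [z|x y]; first by rewrite inE => /eqP ->; rewrite normr0.
  by rewrite !inE => /eqP -> /eqP ->; rewrite eqxx.
have Pbound n : P n -> (n <= size s)%N.
  by move=> /asboolP[U /bound + <-].
have [m /asboolP[U Usep Um] m_max] := ex_maxnP (ex_intro P _ P1) Pbound.
exists m; split; first exact: m_max.
  by apply: ereal_sup_ubound; exists U; rewrite ?Um.
by move=> U' U'1 U'sep; apply: m_max; apply/asboolP; exists U'.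
Qed.

End CompactSeminorm.

(** * Splitting images by quasi-stability *)

Section Splitting.
Context (R : realType) (V : metricType R) (Z : normedModType R).
Context (nZ : Z -> R) (eta kappa sigma : R) (f : V -> V) (B : set V) (K : V -> Z).
Context (m : nat).

Lemma quasi_stable_split (X : set V) (d : R) :
  is_seminorm nZ -> 0 <= eta -> 0 < kappa -> 0 < sigma ->
  (forall x y, B x -> B y -> `|K x - K y| <= kappa * mdist x y /\
     mdist (f x) (f y) <= eta * mdist x y + nZ (K x - K y)) ->
  (forall U : {fset Z}, (forall z, z \in U -> `|z| <= 1) ->
     (forall x y, x \in U -> y \in U -> x != y ->
        sigma / (2 * kappa) <= nZ (x - y)) ->
     (#|` U| <= m)%N) ->
  X `<=` B -> 0 < d -> (forall x y, X x -> X y -> mdist x y <= d) ->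
  exists g : nat -> set V,
    [/\ forall j, g j `<=` f @` X,
        forall j x y, g j x -> g j y -> mdist x y <= (eta + sigma) * d &
        forall y, (f @` X) y -> exists2 j, (j < m)%N & g j y].
Proof.
move=> nZs eta0 kappa0 sigma0 fK mP XB d0 Xd.
have [[v Xv]|Xempty] := pselect (X !=set0); last first.
  by exists (fun=> set0); split=> [j y []|j x y []|y [x Xx _]]; case: Xempty; exists x.
have [_ _ nZsc] := nZs.
have kd0 : 0 < kappa * d by rewrite mulr_gt0.
pose r := sigma * d / 2.
have r0 : 0 < r by rewrite divr_gt0// mulr_gt0.
pose separated (s : seq V) := [/\ uniq s, forall x, x \in s -> X x &
  forall x y, x \in s -> y \in s -> x != y -> r <= nZ (K x - K y)].
(* Recentring at [K v] and dividing by [kappa * d] sends [X] into the unit ball, as [K] is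
   [kappa]-Lipschitz on [B]; the separation [r] becomes [sigma / (2 * kappa)]. *)
pose h x := (kappa * d)^-1 *: (K x - K v).
have nZh x y : nZ (h x - h y) = (kappa * d)^-1 * nZ (K x - K y).
  by rewrite -scalerBr nZsc opprB addrA subrK ger0_norm// invr_ge0 ltW.
have bound s : separated s -> (size s <= m)%N.
  move=> [s_uniq sX s_sep].
  have nZh_ge x y : x \in s -> y \in s -> x != y ->
      sigma / (2 * kappa) <= nZ (h x - h y).
    move=> xs ys xy; rewrite nZh.
    have -> : sigma / (2 * kappa) = (kappa * d)^-1 * r.
      by rewrite /r; field; rewrite !gt_eqF.
    by rewrite ler_pM2l ?invr_gt0// s_sep.
  have h_inj : {in s &, injective h}.
    move=> x y xs ys hxy; apply/eqP/negPn/negP => /(nZh_ge _ _ xs ys).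
    by rewrite hxy subrr seminorm0// leNgt divr_gt0// mulr_gt0.
  have := mP [fset z in [seq h x | x <- s]]%fset.
  rewrite card_fseq undup_id ?map_inj_in_uniq// size_map; apply.
    move=> z; rewrite inE => /mapP[x xs ->].
    rewrite normrZ ger0_norm ?invr_ge0 ?(ltW kd0)// mulrC ler_pdivrMr// mul1r.
    have [Kxv _] := fK _ _ (XB _ (sX _ xs)) (XB _ Xv).
    by rewrite (le_trans Kxv)// ler_pM2l// Xd//; exact: sX.
  move=> _ _ /[!inE] /mapP[x xs ->] /mapP[y ys ->] hxy.
  by apply: nZh_ge => //; apply: contraNneq hxy => ->.
pose P n := `[< exists2 s, separated s & size s = n >].
have P0 : P 0 by apply/asboolP; exists [::].
have Pbound n : P n -> (n <= m)%N by move=> /asboolP[s /bound + <-].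
have [n /asboolP[s [s_uniq sX s_sep] sn] n_max] := ex_maxnP (ex_intro P _ P0) Pbound.
(* A point of [X] far from every centre could be prepended to [s], against maximality. *)
have near_s x : X x -> exists2 p, p \in s & nZ (K x - K p) < r.
  move=> Xx; apply: contrapT => far.
  have {}far p : p \in s -> r <= nZ (K x - K p).
    by move=> ps; rewrite leNgt; apply/negP => lt_r; apply: far; exists p.
  have : P n.+1; last by move=> /n_max; rewrite ltnn.
  apply/asboolP; exists (x :: s); last by rewrite /= sn.
  split=> [/=|p|p q].
  - rewrite s_uniq andbT; apply/negP => /far.
    by rewrite subrr seminorm0// leNgt r0.
  - by rewrite in_cons => /predU1P[->//|/sX].
  - rewrite !in_cons => /predU1P[->|ps] /predU1P[->|qs].
    + by rewrite eqxx.
    + by move=> _; exact: far.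
    + by move=> _; rewrite seminormB_sym//; exact: far.
    + exact: s_sep.
(* Within a piece the seminorm term is at most [2 * r = sigma * d]. For [j] beyond the size of [s]
   the centre is the default [v], and the first two properties still hold. *)
exists (fun j => f @` [set x | X x /\ nZ (K x - K (nth v s j)) < r]); split.
- by move=> j _ [x [Xx _] <-]; exists x.
- move=> j _ _ [x [Xx xr] <-] [y [Xy yr] <-].
  have [_ fxy] := fK _ _ (XB _ Xx) (XB _ Xy).
  rewrite (le_trans fxy)// mulrDl lerD//; first by rewrite ler_wpM2l// Xd.
  rewrite (le_trans (seminorm_triangle _ (K (nth v s j)) _ nZs))//.
  rewrite (_ : sigma * d = r + r); last by rewrite /r; field.
  by rewrite lerD ?ltW// seminormB_sym.
- move=> _ [x Xx <-]; have [p ps xp] := near_s x Xx.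
  exists (index p s); last by exists x => //; rewrite nth_index.
  by rewrite (leq_trans _ (bound s _))// index_mem.
Qed.

End Splitting.

(** * Nets of the forward images *)

Section Nets.
Context (R : realType) (V : metricType R) (f : V -> V) (B : set V).
Context (a D : R) (m : nat).

Lemma iter_image_sub n : f @` B `<=` B -> iter n.+1 f @` B `<=` iter n f @` B.
Proof.
move=> fB _ [x Bx <-]; rewrite iterSr.
by exists (f x) => //; apply: fB; exists x.
Qed.

Lemma iter_image_sub_le n k : f @` B `<=` B -> (n <= k)%N ->
  iter k f @` B `<=` iter n f @` B.
Proof.
move=> fB /subnK <-; elim: (k - n)%N => // j IHj.
exact: subset_trans (iter_image_sub fB) IHj.
Qed.

Context (f_split : forall (X : set V) (d : R), X `<=` B -> 0 < d ->
  (forall x y, X x -> X y -> mdist x y <= d) ->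
  exists g : nat -> set V,
    [/\ forall j, g j `<=` f @` X,
        forall j x y, g j x -> g j y -> mdist x y <= a * d &
        forall y, (f @` X) y -> exists2 j, (j < m)%N & g j y]).
Context (fB : f @` B `<=` B) (a0 : 0 < a) (D0 : 0 < D) (m0 : (0 < m)%N).
Context (BD : forall x y, B x -> B y -> mdist x y <= D).

(** Each of the [m ^ n] pieces of level [n] splits into [m] pieces of the next level. Pieces stay
    inside [B], where [f_split] applies, because [f] maps [B] into itself. *)
Lemma iter_image_cover n : exists c : nat -> set V,
  [/\ forall j, c j `<=` iter n f @` B,
      forall j x y, c j x -> c j y -> mdist x y <= a ^+ n * D &
      forall y, (iter n f @` B) y -> exists2 j, (j < m ^ n)%N & c j y].
Proof.
elim: n => [|n [c [cW cd cover]]].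
  exists (fun=> B); split=> [j|j x y|y]; rewrite ?image_id//.
  - by rewrite expr0 mul1r; exact: BD.
  - by exists 0%N.
have /choice[g gP] : forall j, exists g : nat -> set V,
    [/\ forall i, g i `<=` f @` c j,
        forall i x y, g i x -> g i y -> mdist x y <= a * (a ^+ n * D) &
        forall y, (f @` c j) y -> exists2 i, (i < m)%N & g i y].
  move=> j; apply: f_split; last exact: cd.
  - move=> x /cW Wx; have := iter_image_sub_le fB (leq0n n) Wx.
    by rewrite image_id.
  - by rewrite mulr_gt0// exprn_gt0.
(* Sub-piece [i] of piece [j] gets the index [j * m + i], decoded by quotient and remainder. *)
exists (fun k => g (k %/ m)%N (k %% m)%N); split=> [k y|k x y|_ [x Bx <-]].
- have [gc _ _] := gP (k %/ m)%N; move=> /gc[x /cW[b Bb <-] <-].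
  by exists b.
- by have [_ gd _] := gP (k %/ m)%N; rewrite exprS -mulrA; exact: gd.
- have [j jm cj] := cover (iter n f x) (ex_intro2 _ _ x Bx erefl).
  have [_ _ gcover] := gP j.
  have [i im gi] := gcover (f (iter n f x)) (ex_intro2 _ _ _ cj erefl).
  exists (j * m + i)%N.
    rewrite expnSr (leq_trans (n := (j * m + m)%N))// ?ltn_add2l//.
    by rewrite -mulSnr leq_mul2r jm orbT.
  by rewrite divnMDl// divn_small// addn0 modnMDl modn_small.
Qed.

(** Picking one point from each nonempty piece puts the net inside the forward image itself. *)
Lemma iter_image_net n : exists E : seq V,
  [/\ (size E <= m ^ n)%N, forall x, x \in E -> (iter n f @` B) x &
      forall y, (iter n f @` B) y ->
        exists2 x, x \in E & mdist y x <= a ^+ n * D].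
Proof.
have [[v Wv]|Wempty] := pselect (iter n f @` B !=set0); last first.
  by exists [::]; split=> [|//|y Wy]; [|case: Wempty; exists y].
have [c [cW cd cover]] := iter_image_cover n.
have /choice[h hP] : forall j, exists x, c j !=set0 -> c j x.
  move=> j; have [[x cx]|cempty] := pselect (c j !=set0); first by exists x.
  by exists v.
exists [seq h j | j <- iota 0 (m ^ n) & `[< c j !=set0 >]]; split.
- by rewrite size_map size_filter (leq_trans (count_size _ _))// size_iota.
- move=> x /mapP[j]; rewrite mem_filter => /andP[/asboolP/hP cj _] ->.
  exact: cW cj.
- move=> y /cover[j jm cjy].
  have cj : c j !=set0 by exists y.
  exists (h j); last by apply: cd cjy _; exact: hP.
  by apply: map_f; rewrite mem_filter asboolT// mem_iota.
Qed.

Lemma forward_nets : exists Q : nat -> seq V, forall n,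
  [/\ (size (Q n) <= n.+1 * m ^ n)%N, forall x, x \in Q n -> (iter n f @` B) x,
      forall y, (iter n f @` B) y ->
        exists2 x, x \in Q n & mdist y x <= a ^+ n * D &
      forall x, x \in Q n -> f x \in Q n.+1].
Proof.
have [E EP] := choice iter_image_net.
(* Each net receives the image of the previous one, which makes the union forward invariant; [Q n]
   thus gathers images of [n.+1] nets of at most [m ^ n] points each. *)
pose Q := fix Q n := if n is k.+1 then E k.+1 ++ map f (Q k) else E 0%N.
have QW n x : x \in Q n -> (iter n f @` B) x.
  elim: n x => [|n IHn] x /=; first by have [_ EW _] := EP 0%N; exact: EW.
  rewrite mem_cat => /orP[|/mapP[y /IHn[b Bb <-] ->]]; last by exists b.
  by have [_ EW _] := EP n.+1; exact: EW.
exists Q => n; split=> [|x|y Wy|x Qx].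
- elim: n => [|n IHn] /=; first by have [+ _ _] := EP 0%N; rewrite mul1n.
  rewrite size_cat size_map mulSn leq_add//; first by have [] := EP n.+1.
  by rewrite (leq_trans IHn)// leq_mul// leq_pexp2l.
- exact: QW.
- have [_ _ Enet] := EP n; have [x Ex yx] := Enet y Wy; exists x => //.
  by case: n Ex {yx Enet Wy} => //= n Ex; rewrite mem_cat Ex.
- by rewrite /= mem_cat map_f ?orbT.
Qed.

End Nets.

(** * Total boundedness in complete metric spaces *)

Section Metric.
Context (R : realType) (V : metricType R).
Implicit Types (x y : V) (e : R).

Lemma mcvgP T (F : set_system T) (FF : Filter F) (g : T -> V) x :
  g @ F --> x <-> forall e, 0 < e -> \forall t \near F, mdist x (g t) < e.
Proof. exact: metricType_numDomainType.cvgrPdist_lt. Qed.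

Lemma mclosureP (A : set V) x :
  closure A x <-> forall e, 0 < e -> exists2 y, A y & mdist x y < e.
Proof.
split=> [clAx e e0|Ax U /nbhs_ballP[e /= e0 eU]].
  have [|y [Ay]] := clAx (ball x e); first exact: nbhsx_ballx.
  by rewrite ballEmdist; exists y.
have [y Ay xy] := Ax e e0; exists y; split=> //; apply: eU.
by rewrite ballEmdist.
Qed.

Lemma mbounded_closure (A : set V) : mbounded A -> mbounded (closure A).
Proof.
move=> [M AM]; exists (M + 2) => x y /mclosureP/(_ 1 ltr01)[x' Ax' xx'].
move=> /mclosureP/(_ 1 ltr01)[y' Ay' yy'].
have := metric_triangle x x' y; have := metric_triangle x' y' y.
have := AM x' y' Ax' Ay'; rewrite (metric_sym y' y); lra.
Qed.

Lemma mbounded_sub (A C : set V) : A `<=` C -> mbounded C -> mbounded A.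
Proof. by move=> AC [M CM]; exists M => x y /AC Cx /AC; exact: CM. Qed.

(** An ultrafilter contains each ball or its complement, so the induction either stops at the first
    ball or discards it. *)
Lemma ultra_finite_cover (F : set_system V) (s : seq V) e : UltraFilter F ->
  F [set y | exists2 x, x \in s & mdist x y < e] -> exists x, F (ball x e).
Proof.
move=> FU; elim: s => [|x s IHs] Fs.
  suff : F set0 by move/filter_not_empty.
  by apply: filterS Fs => y [].
have [Fx|Fx] := in_ultra_setVsetC (ball x e) FU; first by exists x.
apply: IHs; apply: filterS (filterI Fs Fx) => y [[z]].
rewrite in_cons => /predU1P[-> xy []|zs zy _]; last by exists z.
by rewrite ballEmdist.
Qed.

Context (V_complete : complete_space V).

Lemma ultra_totally_bounded_cvg (F : set_system V) : UltraFilter F ->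
  (forall e, 0 < e ->
     exists s : seq V, F [set y | exists2 x, x \in s & mdist x y < e]) ->
  exists x, F --> x.
Proof.
move=> FU Ftb; apply: V_complete; apply: cauchy_exP => e e0.
have [s Fs] := Ftb e e0; exact: ultra_finite_cover Fs.
Qed.

Lemma totally_bounded_compact (A : set V) : closed A ->
  (forall e, 0 < e ->
     exists s : seq V, forall y, A y -> exists2 x, x \in s & mdist x y < e) ->
  compact A.
Proof.
move=> Acl Atb; rewrite compact_ultra => F FU FA.
have [x Fx] : exists x, F --> x.
  apply: ultra_totally_bounded_cvg => e /Atb[s sP]; exists s.
  exact: filterS FA.
exists x; split=> //; apply: Acl => U /Fx FUx.
exact: filter_ex (filterI FA FUx).
Qed.

(** The limit of an ultrafilter finer than the tails of [u] is a cluster point of [u]. The bound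
    [k <= phi k] stands in for monotonicity: it suffices to carry over limits and tail
    properties. *)
Lemma totally_bounded_subseq (u : nat -> V) :
  (forall e, 0 < e -> exists (s : seq V) (N : nat),
     forall k, (N <= k)%N -> exists2 x, x \in s & mdist x (u k) < e) ->
  exists (x : V) (phi : nat -> nat),
    (forall k, (k <= phi k)%N) /\ (fun k => u (phi k)) @ \oo --> x.
Proof.
move=> utb.
have [G [GU uG]] := @ultraFilterLemma _ (u @ \oo) _.
have [x Gx] : exists x, G --> x.
  apply: ultra_totally_bounded_cvg => e /utb[s [N sP]]; exists s.
  by apply: uG; exists N.
have /choice[phi phiP] : forall k, exists j, (k <= j)%N /\ mdist x (u j) < k.+1%:R^-1.
  move=> k.
  have Gk : G (u @` [set j | (k <= j)%N]).
    by apply: uG; exists k => // j /= kj; exists j.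
  have Gball : G (ball x (k.+1%:R^-1 : R)) by apply: Gx; exact: nbhsx_ballx.
  have [_ [[j kj <-]]] := filter_ex (filterI Gk Gball).
  by rewrite ballEmdist => xj; exists j.
exists x, phi; split=> [k|]; first by have [] := phiP k.
apply/mcvgP => e e0.
have [N _ NP] := near_infty_natSinv_lt (PosNum e0).
exists N => // k Nk; exact: lt_trans (phiP k).2 (NP k Nk).
Qed.

End Metric.

(** * Fractal dimension *)

Lemma exprM_lt (R : realType) (a D e : R) : 0 < a < 1 -> 0 < D -> 0 < e ->
  exists n, a ^+ n * D < e.
Proof.
move=> /andP[a0 a1] D0 e0.
have a_norm : `|a| < 1 by rewrite gtr0_norm.
have ae : 0 < e / D by rewrite divr_gt0.
have /cvgrPdist_lt/(_ _ ae)[N _ NP] := cvg_expr a_norm.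
exists N; have := NP N (leqnn N).
by rewrite /= sub0r normrN ger0_norm ?exprn_ge0 ?(ltW a0)// ltr_pdivlMr.
Qed.

(* Since [ln x] is sublinear, the polynomial factor [k.+2 ^ 2] is absorbed by
   the slack [rho]. *)
Lemma ln_growth_bound (R : realType) (a D rho : R) (m : nat) :
  0 < a < 1 -> 0 < rho -> (0 < m)%N ->
  exists N : nat, forall k, (N <= k)%N -> forall L,
    k%:R * ln a^-1 - ln D <= L ->
    ln ((k.+2 ^ 2 * m ^ k.+1)%:R : R) <= (ln m%:R / ln a^-1 + rho) * L.
Proof.
move=> /andP[a0 a1] rho0 m0.
set l := ln a^-1; set c := ln m%:R / l.
have l0 : 0 < l by rewrite ln_gt0// invf_gt1.
have c0 : 0 <= c by rewrite divr_ge0 ?(ltW l0)// ln_ge0// ler1n.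
have lnm : ln m%:R = c * l by rewrite /c divfK// gt_eqF.
(* The estimate [ln x <= delta * x - ln delta] spends half of the slack [k%:R * rho * l] on
   [2 * ln k.+2%:R]; the other half absorbs the constants collected in [C] once [k] is large. *)
pose delta := rho * l / 4.
have delta0 : 0 < delta by rewrite divr_gt0// mulr_gt0.
pose C := rho * l - 2 * ln delta + (c + rho) * ln D + l * c.
exists (Num.bound (C / (rho * l / 2))) => k Nk L kL.
have {}Nk : C <= k%:R * (rho * l / 2).
  rewrite -ler_pdivrMr ?divr_gt0 ?mulr_gt0//.
  rewrite (le_trans (ltW (unstable.ltr_bound _)))//.
  by rewrite ler_nat.
have -> : ln ((k.+2 ^ 2 * m ^ k.+1)%:R : R) = 2 * ln k.+2%:R + k.+1%:R * (c * l).
  rewrite natrM !natrX lnM ?posrE ?exprn_gt0 ?ltr0n// !lnXn ?ltr0n// lnm.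
  by congr (_ + _); rewrite -[LHS]mulr_natl.
have lnk : ln (k.+2%:R : R) <= delta * k.+2%:R - ln delta.
  rewrite lerBrDl -lnM ?posrE ?ltr0n//.
  by rewrite ltW// ln_sublinear// mulr_gt0.
have : (c + rho) * (k%:R * l - ln D) <= (c + rho) * L.
  by rewrite ler_wpM2l// addr_ge0// ltW.
apply: le_trans.
have k2 : (k.+2%:R : R) = k%:R + 2 by rewrite -addn2 natrD.
have k1 : (k.+1%:R : R) = k%:R + 1 by rewrite -addn1 natrD.
move: Nk lnk; rewrite k2 k1 /C.
have -> : rho * l = 4 * delta by rewrite /delta; field.
have -> : (c + rho) * (k%:R * l - ln D) =
  k%:R * (c * l) + k%:R * (4 * delta) - (c + rho) * ln D.
  by rewrite /delta; field.
lra.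
Qed.

Section FractalDim.
Context (R : realType) (V : metricType R).

Lemma covering_number_ge0 (M : set V) (e : R) : (0 <= covering_number M e)%E.
Proof. by apply: le_ereal_inf_tmp => _ [C _ <-]; rewrite lee_fin ler0n. Qed.

Lemma covering_number_le (M : set V) (e : R) (s : seq V) (n : nat) :
  (forall x, x \in s -> M x) ->
  (forall y, M y -> exists2 x, x \in s & mdist x y < e) ->
  (size s <= n)%N -> (covering_number M e <= n%:R%:E)%E.
Proof.
move=> sM scover sn; apply: (@le_trans _ _ (#|` [fset x in s]%fset|%:R%:E)%E).
  apply: ereal_inf_lbound; exists [fset x in s]%fset => //; split.
    by move=> x /=; rewrite inE => /sM.
  move=> y /scover[x xs xy]; exists x; first by rewrite /= inE.
  by rewrite ballEmdist.
by rewrite lee_fin ler_nat card_fseq (leq_trans (size_undup s)).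
Qed.

Lemma loge_le (b : R) (x : \bar R) (n : nat) : 1 < b -> (0 < n)%N ->
  (0 <= x)%E -> (x <= n%:R%:E)%E -> (loge b x <= (ln n%:R / ln b)%:E)%E.
Proof.
move=> b1 n0 x0 xn; have lnb0 : 0 < ln b by rewrite ln_gt0.
rewrite /loge inver gt_eqF// EFinM lee_wpmul2r//.
  by rewrite lee_fin invr_ge0 ltW.
rewrite -lne_EFin ?ltr0n// lee_lne ?in_itv/= ?x0 ?leey//.
by rewrite lee_fin ler0n.
Qed.

Lemma le_loge_nat (b : R) (x : \bar R) (n : nat) : 1 < b ->
  (0 < n)%N -> (n%:R%:E <= x)%E -> ((ln n%:R / ln b)%:E <= loge b x)%E.
Proof.
move=> b1 n0 nx; have lnb0 : 0 < ln b by rewrite ln_gt0.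
have n0x : (0%:E <= n%:R%:E :> \bar R)%E by rewrite lee_fin ler0n.
rewrite /loge inver gt_eqF// EFinM lee_wpmul2r//.
  by rewrite lee_fin invr_ge0 ltW.
rewrite -lne_EFin ?ltr0n// lee_lne// in_itv/= leey andbT//.
exact: le_trans nx.
Qed.

(** For small [e] take the least [n = k.+1] with [a ^+ n * D < e]. Then [C n] is the cover, while
    [e <= a ^+ k * D] bounds [ln e^-1] below by [k%:R * ln a^-1 - ln D], as [ln_growth_bound]
    asks. *)
Lemma fractal_dim_le (M : set V) (C : nat -> seq V) (a D : R) (m : nat) :
  0 < a < 1 -> 0 < D -> (0 < m)%N ->
  (forall n x, x \in C n -> M x) ->
  (forall n, (size (C n) <= n.+1 ^ 2 * m ^ n)%N) ->
  (forall n e, a ^+ n * D < e ->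
     forall y, M y -> exists2 x, x \in C n & mdist x y < e) ->
  (fractal_dim M <= (ln m%:R / ln a^-1)%:E)%E.
Proof.
move=> a01 D0 m0 CM Csize Ccover; have /andP[a0 a1] := a01.
apply/lee_addgt0Pr => rho rho0.
have [N NP] := ln_growth_bound D a01 rho0 m0.
(* The bound [1] makes [ln e^-1] positive; the bound [a ^+ N * D] forces the least exponent above
   [N]. *)
pose e0 := Num.min 1 (a ^+ N * D).
have e00 : 0 < e0 by rewrite lt_min ltr01 mulr_gt0// exprn_gt0.
apply: (@le_trans _ _ (ereal_sup
    ((fun e : R => loge e^-1 (covering_number M e)) @` [set e | 0 < e < e0]))).
  apply: ereal_inf_lbound; exists [set e | 0 < e < e0] => //=.
  near=> e; apply/andP; split; near: e; first exact: nbhs_right_gt.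
  exact: nbhs_right_lt.
apply: ge_ereal_sup => _ [e /= /andP[epos] + <-].
rewrite lt_min => /andP[e1 eN].
have Cex : exists n, a ^+ n * D < e by exact: exprM_lt.
have [[|k] ke kmin] := ex_minnP Cex.
  move: ke; rewrite ltNge (le_trans (ltW eN))//.
  by rewrite ler_pM2r// ler_wiXn2l// ltW.
have Nk : (N <= k)%N.
  rewrite -ltnS ltnNge; apply/negP => kN.
  move: (lt_trans ke eN); rewrite ltr_pM2r// ltNge ler_wiXn2l//; exact: ltW.
have ek : e <= a ^+ k * D.
  by rewrite leNgt; apply/negP => /kmin; rewrite ltnn.
have L0 : 0 < ln e^-1 by rewrite ln_gt0// invf_gt1.
have cov := covering_number_le (CM k.+1) (Ccover k.+1 e ke) (Csize k.+1).
rewrite (le_trans (loge_le _ _ (covering_number_ge0 M e) cov))//.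
- by rewrite invf_gt1.
- by rewrite muln_gt0 !expn_gt0 m0.
rewrite -EFinD lee_fin ler_pdivrMr// NP//.
have -> : k%:R * ln a^-1 - ln D = - ln (a ^+ k * D).
  rewrite lnM ?posrE ?exprn_gt0// lnXn// lnV// mulr_natl mulNrn.
  by rewrite opprD.
by rewrite lnV// lerN2 ler_ln ?posrE// mulr_gt0// exprn_gt0.
Unshelve. all: by end_near.
Qed.

End FractalDim.

(** * Decreasing sets with geometrically fine nets *)

Section NestedSets.
Context (R : realType) (V : metricType R) (W : nat -> set V).

(** When the [W n] are decreasing iterated images of a set, this is the omega-limit set of that
    set. *)
Definition core : set V := \bigcap_n closure (W n).

Definition with_nets (Q : nat -> seq V) : set V :=
  core `|` [set x | exists n, x \in Q n].

Lemma core_closed : closed core.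
Proof. by apply: closed_bigI => n _; exact: closed_closure. Qed.

Context (V_complete : complete_space V).
Context (W_decr : forall n k, (n <= k)%N -> W k `<=` W n).

Section Core.
Context (W_tb : forall e : R, 0 < e -> exists n (s : seq V),
  forall y, W n y -> exists2 x, x \in s & mdist x y < e).

(** Since [u] eventually enters each [W n], its tails have arbitrarily fine finite nets, and any
    limit along [phi] lies in the closure of every [W n]. *)
Lemma core_subseq (u : nat -> V) :
  (forall n, exists N, forall k, (N <= k)%N -> W n (u k)) ->
  exists (x : V) (phi : nat -> nat), [/\ core x, forall k, (k <= phi k)%N &
    (fun k => u (phi k)) @ \oo --> x].
Proof.
move=> uW.
have [x [phi [phi_ge ux]]] : exists (x : V) (phi : nat -> nat),
    (forall k, (k <= phi k)%N) /\ (fun k => u (phi k)) @ \oo --> x.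
  apply: totally_bounded_subseq => // e /W_tb[n [s sP]].
  by have [N NP] := uW n; exists s, N => k /NP/sP.
exists x, phi; split=> // n _; apply/mclosureP => e e0.
move/mcvgP : ux => /(_ e e0)[M _ MP]; have [N NP] := uW n.
exists (u (phi (maxn N M))); last by apply: MP; rewrite /= leq_maxr.
by apply: NP; rewrite (leq_trans _ (phi_ge _))// leq_maxl.
Qed.

(** Otherwise points [u n] of [W n] stay farther than [e] from the core, yet they accumulate at a
    point of it. *)
Lemma core_attracts (e : R) : 0 < e ->
  exists n, forall y, W n y -> exists2 z, core z & mdist y z <= e.
Proof.
move=> e0; apply: contrapT => far.
have /choice[u uP] : forall n, exists y, W n y /\ forall z, core z -> e < mdist y z.
  move=> n; apply: contrapT => Hn; apply: far; exists n => y Wy.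
  apply: contrapT => Hy; apply: Hn; exists y; split=> // z cz.
  by rewrite ltNge; apply/negP => yz; apply: Hy; exists z.
have [n|x [phi [cx phi_ge /mcvgP/(_ e e0)[N _ NP]]]] := @core_subseq u.
  by exists n => k nk; apply: W_decr nk _ _; have [] := uP k.
have /= := NP N (leqnn N); have := (uP (phi N)).2 x cx.
by rewrite metric_sym => /lt_trans h /h; rewrite ltxx.
Qed.

End Core.

Context (Q : nat -> seq V) (a D : R) (m : nat).
Context (a01 : 0 < a < 1) (D0 : 0 < D) (m0 : (0 < m)%N).
Context (QP : forall n,
  [/\ (size (Q n) <= n.+1 * m ^ n)%N, forall x, x \in Q n -> W n x &
      forall y, W n y -> exists2 x, x \in Q n & mdist y x <= a ^+ n * D]).

Let C n := flatten [seq Q j | j <- iota 0 n.+1].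

Let mem_C n x : reflect (exists2 j, (j <= n)%N & x \in Q j) (x \in C n).
Proof.
apply: (iffP flatten_mapP) => -[j].
  by rewrite mem_iota => /andP[_ jn]; exists j.
by move=> jn xj; exists j => //; rewrite mem_iota.
Qed.

Let size_C n : (size (C n) <= n.+1 ^ 2 * m ^ n)%N.
Proof.
rewrite size_flatten /shape -map_comp sumnE big_map.
have -> : (n.+1 ^ 2 * m ^ n = \sum_(j <- iota 0 n.+1) n.+1 * m ^ n)%N.
  by rewrite big_const_seq count_predT size_iota iter_addn_0 -mulnn -mulnA mulnC.
rewrite big_seq [leqRHS]big_seq leq_sum// => j; rewrite mem_iota => /andP[_ jn].
have [Qj _ _] := QP j.
by rewrite (leq_trans Qj)// leq_mul// leq_pexp2l// -ltnS.
Qed.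

(** The core and the nets past [n] lie in the closure of [W n]; the strict inequality leaves room to
    approximate their points by points of [W n] first. *)
Lemma nets_cover n e : a ^+ n * D < e ->
  forall y, with_nets Q y -> exists2 x, x \in C n & mdist x y < e.
Proof.
move=> ne y My.
suff [[j jn yj]|clWy] : (exists2 j, (j <= n)%N & y \in Q j) \/ closure (W n) y.
- exists y; first by apply/mem_C; exists j.
  rewrite mdistxx (le_lt_trans _ ne)// mulr_ge0 ?exprn_ge0 ?ltW//.
  by case/andP: a01.
- have d0 : 0 < e - a ^+ n * D by rewrite subr_gt0.
  have [z Wz yz] := (mclosureP _ _).1 clWy _ d0.
  have [_ _ /(_ z Wz)[x Qx zx]] := QP n.
  exists x; first by apply/mem_C; exists n.
  rewrite metric_sym (le_lt_trans (metric_triangle y z x))//.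
  by rewrite -(subrK (a ^+ n * D) e) ltr_leD.
- case: My => [/(_ n I)|[j yj]]; first by right.
  have [jn|nj] := leqP j n; [by left; exists j|right].
  apply: subset_closure; apply: W_decr (ltnW nj) _ _.
  by have [_ + _] := QP j; exact.
Qed.

Lemma nets_totally_bounded (e : R) : 0 < e -> exists s : seq V,
  forall y, with_nets Q y -> exists2 x, x \in s & mdist x y < e.
Proof.
by move=> e0; have [n /nets_cover] := exprM_lt a01 D0 e0; exists (C n).
Qed.

Lemma tail_totally_bounded (e : R) : 0 < e -> exists n (s : seq V),
  forall y, W n y -> exists2 x, x \in s & mdist x y < e.
Proof.
move=> e0; have [n ne] := exprM_lt a01 D0 e0; exists n, (Q n) => y Wy.
have [_ _ /(_ y Wy)[x Qx yx]] := QP n; exists x => //.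
by rewrite metric_sym (le_lt_trans yx).
Qed.

(** For each [n] only finitely many points lie outside the closure of [W n], and a finite set is
    closed. So a point of the closure that is in no net lies in the closure of every [W n]. *)
Lemma with_nets_closed : closed (with_nets Q).
Proof.
move=> y clMy; have [[n yn]|notQ] := pselect (exists n, y \in Q n).
  by right; exists n.
left=> n _.
have Mn : with_nets Q `<=` closure (W n) `|` [set` C n].
  move=> x [/(_ n I)|[j xj]]; first by left.
  have [jn|nj] := leqP j n; first by right; apply/mem_C; exists j.
  left; apply: subset_closure; apply: W_decr (ltnW nj) _ _.
  by have [_ + _] := QP j; exact.
have : (closure (W n) `|` [set` C n]) y.
  apply: (_ : closed _) (closureS Mn clMy); apply: closedU.
    exact: closed_closure.
  apply: compact_closed; first exact: metric_hausdorff.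
  by apply: finite_compact; exact: finite_seq.
by case=> // /mem_C[j _ yj]; case: notQ; exists j.
Qed.

Lemma with_nets_compact : compact (with_nets Q).
Proof.
exact: totally_bounded_compact with_nets_closed nets_totally_bounded.
Qed.

Lemma core_compact : compact core.
Proof.
apply: subclosed_compact core_closed with_nets_compact _.
by move=> x cx; left.
Qed.

Lemma with_nets_dim : (fractal_dim (with_nets Q) <= (ln m%:R / ln a^-1)%:E)%E.
Proof.
apply: (@fractal_dim_le _ _ _ C _ D) => //; last exact: nets_cover.
by move=> n x /mem_C[j _ xj]; right; exists j.
Qed.

End NestedSets.

(** * Convergence of semidistances to zero *)

Section Attraction.
Context (R : realType) (V : metricType R).

Lemma hausdorff_semidist_ge0 (G H : set V) : (0 <= hausdorff_semidist G H)%E.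
Proof. by apply: ereal_sup_ubound; left. Qed.

Lemma hausdorff_semidist_le (G H : set V) (r : R) : 0 <= r ->
  (forall x, G x -> exists2 y, H y & mdist x y <= r) ->
  (hausdorff_semidist G H <= r%:E)%E.
Proof.
move=> r0 GH; apply: ge_ereal_sup => _ [->|[x Gx <-]]; first by rewrite lee_fin.
have [y Hy xy] := GH x Gx; apply: (@le_trans _ _ (mdist x y)%:E).
  by apply: ereal_inf_lbound; exists y.
by rewrite lee_fin.
Qed.

Lemma cvge0_within_pinfty (TT : set R) (g : R -> \bar R) :
  (forall t, (0 <= g t)%E) ->
  (forall e, 0 < e -> exists t0, forall t, TT t -> t0 <= t -> (g t <= e%:E)%E) ->
  g t @[t --> within TT (pinfty_nbhs R)] --> 0%E.
Proof.
move=> g0 gP; have near_le e : 0 < e ->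
    \forall t \near within TT (pinfty_nbhs R), (g t <= e%:E)%E.
  move=> /gP[t0 t0P]; rewrite near_withinE; exists t0; split.
    exact: num_real.
  by move=> t tt0 /t0P; apply; exact: ltW.
(* Finiteness near infinity lets the convergence be tested on real values. *)
have near_fin : \forall t \near within TT (pinfty_nbhs R), g t \is a fin_num.
  apply: filterS (near_le 1 ltr01) => t gt1.
  by rewrite ge0_fin_numE// (le_lt_trans gt1)// ltry.
apply/fine_cvgP; split=> //; apply/cvgrPdist_le => e e0.
apply: filterS (filterI near_fin (near_le e e0)) => t [gfin gle].
rewrite /= sub0r normrN ger0_norm ?fine_ge0//.
by rewrite -lee_fin fineK.
Qed.

End Attraction.

(** * Asymptotically closed semigroups *)

Section Semigroup.
Context (R : realType) (V : metricType R).
Context (TT : set R) (S : R -> V -> V) (T : R) (B : set V).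
Context (time_TT : is_time_set TT) (S_semigroup : is_semigroup TT S).
Context (TT_T : TT T) (T0 : 0 < T).

Lemma time_ge0 t : TT t -> 0 <= t.
Proof. by case: time_TT => -> //= -[n _ <-]; rewrite ler0n. Qed.

Lemma time_add s t : TT s -> TT t -> TT (s + t).
Proof.
case: time_TT => -> /=; first exact: addr_ge0.
by move=> [n _ <-] [k _ <-]; exists (n + k)%N => //; rewrite natrD.
Qed.

Lemma time_sub s t : TT s -> TT t -> s <= t -> TT (t - s).
Proof.
case: time_TT => -> /=; first by rewrite subr_ge0.
move=> [n _ <-] [k _ <-]; rewrite ler_nat => nk.
by exists (k - n)%N => //; rewrite natrB.
Qed.

Lemma time_mul n : TT (n%:R * T).
Proof.
elim: n => [|n IHn].
  by rewrite mul0r; case: time_TT => -> //=; exists 0%N.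
by rewrite -natr1 mulrDl mul1r; exact: time_add.
Qed.

Lemma semigroup_iter n x : S (n%:R * T) x = iter n (S T) x.
Proof.
have [S0 SD] := S_semigroup; elim: n => [|n IHn]; first by rewrite mul0r S0.
rewrite -natr1 mulrDl mul1r addrC -SD//; last exact: time_mul.
by rewrite IHn.
Qed.

(* The absorbing set [B] itself need not be mapped into itself by [S T]. *)
Definition invariant_part : set V := [set x | forall k, B (iter k (S T) x)].

Lemma invariant_part_sub : invariant_part `<=` B.
Proof. by move=> x /(_ 0%N). Qed.

Lemma invariant_part_stable : S T @` invariant_part `<=` invariant_part.
Proof. by move=> _ [x Bx <-] k; rewrite -iterSr. Qed.

Let W n := iter n (S T) @` invariant_part.

Context (B_absorbing : absorbing TT S B) (B_bounded : mbounded B).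

(** With [s = t - n%:R * T >= tG], absorption puts [S (k%:R * T + s) x] in [B] for all [k]. So
    [S s x] is in the invariant part, and [n] steps of [S T] lead from it to [S t x]. *)
Lemma absorbed (G : set V) : mbounded G -> exists tG : R,
  forall t n, TT t -> n%:R * T + tG <= t -> S t @` G `<=` W n.
Proof.
move=> /B_absorbing[tG TTG GB]; exists tG => t n TTt nt _ [x Gx <-].
have [_ SD] := S_semigroup.
have nTt : n%:R * T <= t by rewrite (le_trans _ nt)// lerDl time_ge0.
have TTtn : TT (t - n%:R * T) by apply: time_sub => //; exact: time_mul.
exists (S (t - n%:R * T) x).
  move=> k; rewrite -semigroup_iter SD//; last exact: time_mul.
  apply: (GB (k%:R * T + (t - n%:R * T))); last by exists x.
    by apply: time_add => //; exact: time_mul.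
  have := time_ge0 (time_mul k); lra.
by rewrite -semigroup_iter SD ?subrKC//; exact: time_mul.
Qed.

Lemma semigroup_eventually (t_ : nat -> R) (b : nat -> V) :
  (forall k, TT (t_ k)) -> t_ @ \oo --> +oo -> mbounded (range b) ->
  forall n, exists N, forall k, (N <= k)%N -> W n (S (t_ k) (b k)).
Proof.
move=> TTt too /absorbed[tG tGP] n.
move/cvgryPge : too => /(_ (n%:R * T + tG))[N _ NP].
exists N => k /NP Nk; apply: tGP (TTt k) Nk _ _.
by exists (b k) => //; exists k.
Qed.

Lemma cvg_mul_pinfty (phi : nat -> nat) : (forall k, (k <= phi k)%N) ->
  (fun k => (phi k)%:R * T) @ \oo --> +oo.
Proof.
move=> phi_ge; apply/cvgryPge => A; exists (Num.bound (A / T)) => // k /= Ak.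
rewrite -ler_pdivrMr// (le_trans (ltW (unstable.ltr_bound _)))// ler_nat.
exact: leq_trans (phi_ge k).
Qed.

Lemma cvg_subseq (u : nat -> V) (x : V) (phi : nat -> nat) :
  (forall k, (k <= phi k)%N) -> u @ \oo --> x ->
  (fun k => u (phi k)) @ \oo --> x.
Proof.
move=> phi_ge /mcvgP ux; apply/mcvgP => e /ux[N _ NP].
by exists N => // k /= Nk; apply: NP; exact: leq_trans (phi_ge k).
Qed.

(** This gives points of the core the form that asymptotic closedness takes as input. *)
Lemma core_approx x : core W x -> exists b : nat -> V,
  mbounded (range b) /\ (fun k => S (k%:R * T) (b k)) @ \oo --> x.
Proof.
move=> Wx.
have /choice[b bP] : forall k, exists y,
    invariant_part y /\ mdist x (iter k (S T) y) < k.+1%:R^-1.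
  move=> k; have k0 : 0 < k.+1%:R^-1 :> R by rewrite invr_gt0 ltr0n.
  by have [_ [y By <-] xy] := (mclosureP _ _).1 (Wx k I) _ k0; exists y.
exists b; split.
  apply: mbounded_sub B_bounded => _ [k _ <-].
  exact: invariant_part_sub (bP k).1.
apply/mcvgP => e e0; have [N _ NP] := near_infty_natSinv_lt (PosNum e0).
exists N => // k Nk; rewrite semigroup_iter.
exact: lt_trans (bP k).2 (NP k Nk).
Qed.

Context (V_complete : complete_space V).
Context (S_closed : asymptotically_closed TT S).
Context (W_tb : forall e : R, 0 < e -> exists n (s : seq V),
  forall y, W n y -> exists2 x, x \in s & mdist x y < e).

(** Asymptotic closedness stands in for continuity of [S t]. If [S (k%:R * T) (b k)] tends to [x], a
    cluster point of [S (t + k%:R * T) (b k)] is in the core and equals [S t x]; going back by [t]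
    instead yields a preimage of [x] in the core. *)
Lemma core_invariant t : TT t -> S t @` core W = core W.
Proof.
move=> TTt; have [_ SD] := S_semigroup; rewrite eqEsubset; split.
  move=> _ [x /core_approx[b [b_bounded bx]] <-].
  have tk_oo : (fun k => t + k%:R * T) @ \oo --> +oo.
    apply/cvgryPge => A.
    have /cvgryPge/(_ A) := cvg_mul_pinfty (fun k => leqnn k).
    apply: filterS => k /le_trans; apply.
    by rewrite lerDr; exact: time_ge0.
  have TTtk k : TT (t + k%:R * T) by apply: time_add => //; exact: time_mul.
  have [y [phi [cy phi_ge uy]]] :=
    core_subseq V_complete W_tb (semigroup_eventually TTtk tk_oo b_bounded).
  rewrite (S_closed TTt _ (cvg_mul_pinfty phi_ge) _ (cvg_subseq phi_ge bx) uy)//.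
    by move=> k; exact: time_mul.
  by apply: mbounded_sub b_bounded => _ [k _ <-]; exists (phi k).
move=> x /core_approx[b [b_bounded bx]].
(* Shifting the index by [N] keeps all times [s k] nonnegative. *)
pose N := Num.bound (t / T).
have tN k : t <= (k + N)%:R * T.
  rewrite -ler_pdivrMr// (le_trans (ltW (unstable.ltr_bound _)))// ler_nat.
  exact: leq_addl.
pose s k := (k + N)%:R * T - t.
have TTs k : TT (s k) by apply: time_sub => //; exact: time_mul.
have s_oo (psi : nat -> nat) : (forall k, (k <= psi k)%N) ->
    (fun k => s (psi k)) @ \oo --> +oo.
  move=> psi_ge; apply/cvgryPge => A.
  have psiN k : (k <= psi k + N)%N by rewrite (leq_trans (psi_ge k))// leq_addr.
  have /cvgryPge/(_ (A + t)) := cvg_mul_pinfty psiN.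
  by apply: filterS => k; rewrite lerBrDr.
have bN_bounded (psi : nat -> nat) : mbounded (range (fun k => b (psi k))).
  by apply: mbounded_sub b_bounded => _ [k _ <-]; exists (psi k).
have [z [phi [cz phi_ge uz]]] := core_subseq V_complete W_tb
  (semigroup_eventually TTs (s_oo id leqnn) (bN_bounded (addn^~ N))).
exists z => //.
apply: (S_closed TTt (fun k => TTs (phi k)) (s_oo phi phi_ge)
  (bN_bounded (fun k => phi k + N)%N) uz).
have phiN_ge k : (k <= phi k + N)%N by rewrite (leq_trans (phi_ge k))// leq_addr.
have -> : (fun k => S (t + s (phi k)) (b (phi k + N)%N)) =
          (fun k => S ((phi k + N)%:R * T) (b (phi k + N)%N)).
  by apply/funext => k; rewrite /s subrKC.
exact: cvg_subseq phiN_ge bx.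
Qed.

(** [B] need not be closed, so the definition only places the core in the closure of [B]. Being
    bounded, the core is carried into [B] by some [S tA], and invariance concludes. *)
Lemma core_sub : core W `<=` B.
Proof.
have [tA [TTA AB]] : exists tA, TT tA /\ S tA @` core W `<=` B.
  have : mbounded (core W).
    apply: mbounded_sub (mbounded_closure B_bounded) => x /(_ 0%N I).
    by apply: closureS; rewrite /W image_id; exact: invariant_part_sub.
  by move=> /B_absorbing[tA TTA AB]; exists tA; split=> //; exact: AB.
by rewrite core_invariant in AB.
Qed.

(** The orbit of any point, sampled at multiples of [T], accumulates in the core. *)
Lemma core_nonempty : [set: V] !=set0 -> core W !=set0.
Proof.
move=> [v _].
have v_bounded : mbounded (range (fun _ : nat => v)).
  by exists 0 => _ _ [k _ <-] [j _ <-]; rewrite mdistxx.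
have [x [_ [cx _ _]]] := core_subseq V_complete W_tb
  (semigroup_eventually time_mul (cvg_mul_pinfty leqnn) v_bounded).
by exists x.
Qed.

Lemma core_attracting (G : set V) : mbounded G ->
  hausdorff_semidist (S t @` G) (core W)
    @[t --> within TT (pinfty_nbhs R)] --> 0%E.
Proof.
move=> /absorbed[tG tGP]; apply: cvge0_within_pinfty => [t|e e0].
  exact: hausdorff_semidist_ge0.
have W_decr n k : (n <= k)%N -> W k `<=` W n.
  exact: iter_image_sub_le invariant_part_stable.
have [n nP] := core_attracts V_complete W_decr W_tb e0.
exists (n%:R * T + tG) => t TTt nt; apply: hausdorff_semidist_le; first exact: ltW.
by move=> x /(tGP _ _ TTt nt)/nP.
Qed.

(** By time [t], about [(t - tG) / T] contractions by [a] have taken place, so the semidistance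
    decays at rate [T^-1 * ln a^-1] up to a constant; a smaller [xi] leaves the margin [delta]. *)
Lemma geometric_attraction (M : set V) (a D xi : R) :
  0 < a < 1 -> 0 < D ->
  (forall n y, W n y -> exists2 x, M x & mdist y x <= a ^+ n * D) ->
  xi < T^-1 * ln a^-1 -> attracts_at_rate TT S M xi.
Proof.
move=> /andP[a0 a1] D0 MP xi_lt G /absorbed[tG tGP].
apply: cvge0_within_pinfty => [t|e e0].
  by rewrite mule_ge0 ?hausdorff_semidist_ge0// lee_fin expR_ge0.
set l := ln a^-1 in xi_lt.
have l0 : 0 < l by rewrite ln_gt0// invf_gt1.
pose delta := T^-1 * l - xi.
have delta0 : 0 < delta by rewrite subr_gt0.
(* [c] pays for the waiting time [tG] and for rounding down to [n]:
   [xi * t - l * n%:R <= c - delta * t]. *)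
pose c := l * (T^-1 * tG + 1).
exists (Num.max tG ((c - ln (e / D)) / delta)) => t TTt.
rewrite ge_max => /andP[tGt]; rewrite ler_pdivrMr// => t_large.
pose n := Num.trunc ((t - tG) / T).
have /truncn_itv/andP[n_le n_lt] : 0 <= (t - tG) / T.
  by rewrite divr_ge0 ?subr_ge0// ltW.
have nt : n%:R * T + tG <= t by rewrite -lerBrDr -ler_pdivlMr.
have dist_le : (hausdorff_semidist (S t @` G) M <= (a ^+ n * D)%:E)%E.
  apply: hausdorff_semidist_le; first by rewrite mulr_ge0 ?exprn_ge0// ltW.
  by move=> x /(tGP _ _ TTt nt)/MP.
rewrite (le_trans (lee_wpmul2l _ dist_le)) ?lee_fin ?expR_ge0//.
rewrite mulrA -ler_pdivlMr//.
have an : a ^+ n = expR (- (l * n%:R)).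
  by rewrite mulrC -mulrN expRM_natl /l lnV// opprK lnK.
rewrite an -expRD -[leRHS]lnK ?posrE ?divr_gt0// ler_expR.
have : l * ((t - tG) / T) <= l * (n%:R + 1).
  by rewrite ler_pM2l// natr1 ltW.
move: t_large; rewrite /c /delta; lra.
Qed.

End Semigroup.

(** * Construction of both attractors *)

Theorem theorem3p5 (R : realType) (V : metricType R) (Z : normedModType R)
    (TT : set R) (S : R -> V -> V) (T : R) (B : set V) (nZ : Z -> R)
    (eta kappa : R)
    (hV : [set: V] !=set0) (hVc : complete_space V)
    (hTT : is_time_set TT) (hS : is_semigroup TT S)
    (hac : asymptotically_closed TT S)
    (hT : TT T) (hT0 : 0 < T)
    (hBb : mbounded B) (hB : absorbing TT S B)
    (hqs : quasi_stable S B T nZ eta kappa) :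
  forall sigma : R, 0 < sigma < 1 - eta ->
    exists M0 : set V,
      [/\ M0 `<=` B,
          discrete_exponential_attractor TT S T M0,
          forall xi : R, 0 < xi < T^-1 * ln (eta + sigma)^-1 ->
            attracts_at_rate TT S M0 xi,
          (fractal_dim M0 <=
             loge (eta + sigma)^-1 (max_separated nZ (sigma / (2 * kappa))))%E &
          exists A : set V, global_attractor TT S A /\ A `<=` M0].
Proof.
move=> sigma /andP[sigma0 sigma_lt].
have [_ nZc /andP[eta0 eta1] kappa0 [K KP]] := hqs.
set a := eta + sigma.
have a01 : 0 < a < 1 by rewrite /a ltr_wpDl//= addrC -ltrBrDr.
have /andP[a0 a1] := a01.
have b1 : 1 < a^-1 by rewrite invf_gt1.
have mu0 : 0 < sigma / (2 * kappa) by rewrite divr_gt0// mulr_gt0.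
have [m [m0 m_le m_ge]] := max_separated_attained nZc mu0.
pose B' := invariant_part S T B.
have B'B : B' `<=` B by exact: invariant_part_sub.
have B'_stable : S T @` B' `<=` B' by exact: invariant_part_stable.
pose W n := iter n (S T) @` B'.
have [M BM] := hBb.
(* The lower bound [1] keeps [D] positive even when [B] has diameter zero. *)
pose D := Num.max 1 M.
have D0 : 0 < D by rewrite lt_max ltr01.
have B'D x y : B' x -> B' y -> mdist x y <= D.
  by move=> /B'B Bx /B'B By; rewrite le_max BM ?orbT.
have split_B' (X : set V) (d : R) : X `<=` B' -> 0 < d ->
    (forall x y, X x -> X y -> mdist x y <= d) -> exists g : nat -> set V,
    [/\ forall j, g j `<=` S T @` X,
        forall j x y, g j x -> g j y -> mdist x y <= a * d &
        forall y, (S T @` X) y -> exists2 j, (j < m)%N & g j y].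
  move=> XB'; apply: (quasi_stable_split nZc.1 eta0 kappa0 sigma0 KP m_ge).
  exact: subset_trans B'B.
have [Q QP] := forward_nets split_B' B'_stable a0 D0 m0 B'D.
have W_decr n k : (n <= k)%N -> W k `<=` W n.
  exact: iter_image_sub_le B'_stable.
have QP' n : [/\ (size (Q n) <= n.+1 * m ^ n)%N, forall x, x \in Q n -> W n x &
    forall y, W n y -> exists2 x, x \in Q n & mdist y x <= a ^+ n * D].
  by have [] := QP n.
have W_tb := tail_totally_bounded a01 D0 QP'.
have coreS t : TT t -> S t @` core W = core W.
  exact: core_invariant hTT hS hT hT0 hB hBb hVc hac W_tb t.
have rate xi : xi < T^-1 * ln a^-1 -> attracts_at_rate TT S (with_nets W Q) xi.
  apply: (geometric_attraction hTT hS hT hT0 hB a01 D0) => n y Wy.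
  have [_ _ /(_ y Wy)[x Qx yx]] := QP' n.
  by exists x => //; right; exists n.
have dim := with_nets_dim W_decr a01 D0 m0 QP'.
have core_n0 := core_nonempty hTT hS hT hT0 hB hVc W_tb hV.
have rate0 : 0 < T^-1 * ln a^-1 by rewrite mulr_gt0 ?invr_gt0// ln_gt0.
exists (with_nets W Q); split.
- move=> x [|[n]].
    exact: core_sub hTT hS hT hT0 hB hBb hVc hac W_tb x.
  have [_ QW _] := QP' n; move=> /QW/(W_decr _ _ (leq0n n)).
  by rewrite /W image_id; exact: B'B.
- split.
  + by have [x cx] := core_n0; exists x; left.
  + exact (with_nets_compact hVc W_decr a01 D0 QP').
  (* The core is mapped onto itself and each net into the next one. *)
  + move=> _ [x [cx|[n Qx]] <-].
      by left; rewrite -(coreS T hT); exists x.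
    by right; exists n.+1; have [_ _ _] := QP n; exact.
  + exact: le_lt_trans dim (ltry _).
  (* Half of the critical rate is positive and admissible. *)
  + exists (T^-1 * ln a^-1 / 2); first by rewrite divr_gt0.
    by apply: rate; rewrite ltr_pdivrMr// ltr_pMr// ltr1n.
- by move=> xi /andP[_]; exact: rate.
- by rewrite (le_trans dim)// le_loge_nat.
- exists (core W); split; last by move=> x cx; left.
  split=> //; first exact (core_compact hVc W_decr a01 D0 QP').
  exact: core_attracting hTT hS hT hB hVc W_tb.
Qed.
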